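(* Let $\phi:\Gamma\to\Lambda$ be a nonzero epimorphism of finitely generated groups $\Gamma,\Lambda$. Then $\mathrm{cd}(\phi)=0$ if and only if $\Gamma$ is the trivial group.
   Context: For a homomorphism $\phi:\Gamma\to\Lambda$ of discrete groups, the cohomological dimension $\mathrm{cd}(\phi)$ is the maximum of all $k$ such that there is a $\mathbb{Z}\Lambda$-module $M$ with nonzero induced homomorphism $\phi^*:H^k(\Lambda,M)\to H^k(\Gamma,M)$ ($\infty$ if there is no maximum). ''Nonzero'' means that $\phi$ is not the trivial homomorphism. *)

(* Defs.v *)
From HB Require Import structures.
From mathcomp Require Import all_boot all_order all_algebra.
From mathcomp Require Import boolp classical_sets functions.

Set Implicit Arguments.
Unset Strict Implicit.
Unset Printing Implicit Defensive.

Import GRing.Theory.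

Local Open Scope ring_scope.
Local Open Scope quotient_scope.

(* A Z[G]-module, given as an abelian group with an action of G by
   additive maps: by the universal property of the group ring this is the same
   as a unitary ring morphism from Z[G] to the endomorphisms of the group. *)
Record gmodule (G : groupType) := GModule {
  gmod_sort :> zmodType;
  gact : G -> gmod_sort -> gmod_sort;
  gactD : forall g, {morph gact g : u v / u + v};
  gact1 : forall u, gact 1%g u = u;
  gactM : forall g h u, gact (g * h)%g u = gact g (gact h u)
}.

Section RestrictionOfScalars.
Variables (G L : groupType) (phi : UMagmaMorphism.type G L) (M : gmodule L).

Definition res_act (g : G) : M -> M := gact (phi g).

Fact res_actD g : {morph res_act g : u v / u + v}.
Proof. exact: gactD. Qed.

Fact res_act1 u : res_act 1%g u = u.
Proof. by rewrite /res_act gmulf1 gact1. Qed.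

Fact res_actM g h u : res_act (g * h)%g u = res_act g (res_act h u).
Proof. by rewrite /res_act gmulfM gactM. Qed.

Definition res_gmodule : gmodule G := GModule res_actD res_act1 res_actM.

End RestrictionOfScalars.

(* H^n(G; M) is computed with homogeneous cochains, i.e. as the cohomology of
   Hom_G(F, M) for F the standard free resolution of Z over Z[G], in which F_n
   has Z-basis the (n+1)-tuples (g_0, ..., g_n). *)
Section Cohomology.
Variables (G : groupType) (M : gmodule G).

Definition cochain (n : nat) := ('I_n.+1 -> G) -> M.

Definition equivariant n (f : cochain n) :=
  forall (g : G) (x : 'I_n.+1 -> G), f (fun i => g * x i)%g = gact g (f x).

(* x \o lift i is the tuple x with its i-th entry omitted. *)
Definition diff n (f : cochain n) : cochain n.+1 :=
  fun x => \sum_(i < n.+2) f (x \o lift i) *~ (-1) ^+ i.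

Definition is_cocycle n (f : cochain n) := equivariant f /\ diff f = 0.

Definition is_coboundary n : cochain n -> Prop :=
  match n with
  | 0 => fun f => f = 0
  | m.+1 => fun f => exists2 h : cochain m, equivariant h & f = diff h
  end.

Lemma gactB g (u v : M) : gact g (u - v) = gact g u - gact g v.
Proof. by apply/eqP; rewrite eq_sym subr_eq -gactD subrK. Qed.

Lemma gact0 g : gact g (0 : M) = 0.
Proof. by rewrite -[0 in LHS](subrr (0 : M)) gactB subrr. Qed.

Lemma gactN g (u : M) : gact g (- u) = - gact g u.
Proof. by rewrite -[- u]sub0r gactB gact0 sub0r. Qed.

Lemma equivariant0 n : equivariant (0 : cochain n).
Proof. by move=> g x; rewrite gact0. Qed.

Lemma equivariantB n (f h : cochain n) :
  equivariant f -> equivariant h -> equivariant (f - h).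
Proof.
by move=> fE hE g x; rewrite !fctE /= fE hE gactB.
Qed.

Lemma diffB n (f h : cochain n) : diff (f - h) = diff f - diff h.
Proof.
apply/funext => x; rewrite !fctE /diff /= -sumrB.
by apply: eq_bigr => i _; rewrite -mulrzBl.
Qed.

Lemma diff0 n : diff (0 : cochain n) = 0.
Proof. by rewrite -[0 in LHS](subrr (0 : cochain n)) diffB subrr. Qed.

Lemma equivariant_diff n (f : cochain n) : equivariant f -> equivariant (diff f).
Proof.
move=> fE g x; rewrite /diff (big_morph (gact g) (gactD g) (gact0 g)).
apply: eq_bigr => i _.
have -> : (fun j => g * x j)%g \o lift i = (fun j => g * (x \o lift i) j)%g by [].
rewrite fE -signr_odd; case: (odd i); rewrite ?expr1 ?expr0 ?mulr1z //.
by rewrite !mulrN1z gactN.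
Qed.

Lemma lift_lift n (i : 'I_n.+3) (j : 'I_n.+2) (k : 'I_n.+1) :
  (j < i)%N ->
  lift i (lift j k) = lift (inord j : 'I_n.+3) (lift (inord i.-1 : 'I_n.+2) k).
Proof.
move=> ji; have iE : i = i.-1.+1 :> nat by case: (i : nat) ji.
apply: val_inj; rewrite /= !inordK; last first.
- exact: ltnW (ltn_ord j).
- by rewrite -ltnS -iE.
rewrite bumpC.
have -> : bump i j = j by rewrite /bump leqNgt ji.
by rewrite /unbump ji subn1.
Qed.

Lemma diff_diff n (f : cochain n) : diff (diff f) = 0.
Proof.
apply/funext => x; suff : diff (diff f) x = 0 :> M by [].
rewrite /diff; pose F (i : 'I_n.+3) (j : 'I_n.+2) :=
  f (x \o lift i \o lift j) *~ ((-1) ^+ i * (-1) ^+ j).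
have -> : \sum_(i < n.+3) (\sum_(j < n.+2)
    f ((x \o lift i) \o lift j) *~ (-1) ^+ j) *~ (-1) ^+ i =
    \sum_i \sum_j F i j.
  apply: eq_bigr => i _; rewrite mulrz_suml; apply: eq_bigr => j _.
  by rewrite /F mulrC mulrzA.
rewrite pair_bigA /= (bigID (fun p : 'I_n.+3 * 'I_n.+2 => (p.2 < p.1)%N)) /=.
rewrite [X in _ + X](reindex_onto
  (fun p : 'I_n.+3 * 'I_n.+2 => (inord p.2 : 'I_n.+3, inord p.1.-1 : 'I_n.+2))
  (fun p : 'I_n.+3 * 'I_n.+2 => (inord p.2.+1 : 'I_n.+3, inord p.1 : 'I_n.+2))) /=.
  rewrite [X in _ + X](eq_bigl (fun p : 'I_n.+3 * 'I_n.+2 => p.2 < p.1)%N).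
    rewrite -big_split /= big1// => -[i j] /= ji.
    have iE : i = i.-1.+1 :> nat by case: (i : nat) ji.
    have jn : (j < n.+3)%N by exact: ltnW (ltn_ord j).
    have iN : (i.-1 < n.+2)%N by rewrite -ltnS -iE.
    rewrite /F !inordK//.
    have -> : x \o lift (inord j : 'I_n.+3) \o lift (inord i.-1 : 'I_n.+2) =
              x \o lift i \o lift j.
      by apply/funext => k /=; rewrite (lift_lift _ ji).
    rewrite -mulrzDr [in (-1) ^+ i]iE exprS mulN1r mulNr.
    by rewrite [X in _ + X]mulrC addNr mulr0z.
  move=> [i j] /=; have jn : (j < n.+3)%N by exact: ltnW (ltn_ord j).
  rewrite (inordK jn); have [i0|i0] := posnP i.
    by rewrite i0 ltn0 inordK//= xpair_eqE -val_eqE /= inordK// i0 andbF.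
  have iE : i.-1.+1 = i by rewrite prednK.
  have iN : (i.-1 < n.+2)%N by rewrite -ltnS iE.
  by rewrite (inordK iN) iE !inord_val eqxx andbT -ltnNge.
move=> [i j] /=; rewrite -leqNgt => ij.
have iN : (i < n.+2)%N by exact: leq_ltn_trans ij (ltn_ord j).
by congr pair; apply: val_inj; rewrite /= !inordK//= ltnS.
Qed.

Lemma is_coboundary_cocycle n (f : cochain n) : is_coboundary f -> is_cocycle f.
Proof.
case: n f => [|n] f /=; first by move->; split; [exact: equivariant0|exact: diff0].
by case=> h hE ->; split; [exact: equivariant_diff|exact: diff_diff].
Qed.

Lemma is_cocycleB n (f h : cochain n) :
  is_cocycle f -> is_cocycle h -> is_cocycle (f - h).
Proof.
move=> [fE f0] [hE h0]; split; first exact: equivariantB.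
by rewrite diffB f0 h0 subrr.
Qed.

Lemma is_coboundary0 n : is_coboundary (0 : cochain n).
Proof.
by case: n => [|n] //=; exists 0; [exact: equivariant0|rewrite diff0].
Qed.

Lemma is_coboundaryB n (f h : cochain n) :
  is_coboundary f -> is_coboundary h -> is_coboundary (f - h).
Proof.
case: n f h => [|n] f h /=; first by move=> -> ->; rewrite subrr.
move=> [f' f'E ->] [h' h'E ->]; exists (f' - h'); first exact: equivariantB.
by rewrite diffB.
Qed.

Definition cocycles n : {pred cochain n} := fun f => `[< is_cocycle f >].

Fact cocycles_zmod_closed n : zmod_closed (@cocycles n).
Proof.
split; first by apply/asboolP/is_coboundary_cocycle/is_coboundary0.
by move=> f h /asboolP fZ /asboolP hZ; apply/asboolP/is_cocycleB.
Qed.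

HB.instance Definition _ n :=
  GRing.isZmodClosed.Build (cochain n) (@cocycles n) (@cocycles_zmod_closed n).

Record cocycle n := Cocycle {
  cocycle_val :> cochain n;
  cocycleP : cocycle_val \in @cocycles n
}.

HB.instance Definition _ n := [isSub for @cocycle_val n].
HB.instance Definition _ n := [Choice of cocycle n by <:].
HB.instance Definition _ n := [SubChoice_isSubZmodule of cocycle n by <:].

Definition coboundaries n : {pred cocycle n} :=
  fun z => `[< is_coboundary (cocycle_val z) >].

Fact coboundaries_zmod_closed n : zmod_closed (@coboundaries n).
Proof.
split; first by apply/asboolP/is_coboundary0.
by move=> f h /asboolP fB /asboolP hB; apply/asboolP/is_coboundaryB.
Qed.

HB.instance Definition _ n := GRing.isZmodClosed.Build
  (cocycle n) (@coboundaries n) (@coboundaries_zmod_closed n).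

Definition cohomology n := Quotient.quot (@coboundaries n).

End Cohomology.

Arguments cocycle {G} M n.
Arguments cohomology {G} M n.

Section InducedMap.
Variables (G L : groupType) (phi : UMagmaMorphism.type G L) (M : gmodule L).
Variable n : nat.

Definition pullback m (f : cochain M m) : cochain (res_gmodule phi M) m :=
  fun x => f (phi \o x).

Lemma equivariant_pullback m (f : cochain M m) :
  equivariant f -> equivariant (pullback f).
Proof.
move=> fE g x; apply: etrans (fE (phi g) (phi \o x)); rewrite /pullback.
by congr f; apply/funext => i /=; rewrite gmulfM.
Qed.

Lemma diff_pullback m (f : cochain M m) :
  diff (pullback f) = pullback (diff f).
Proof. by []. Qed.

Fact pullback_cocycle (z : cocycle M n) :
  pullback z \in @cocycles G (res_gmodule phi M) n.
Proof.
case: z => f /= /asboolP[fE f0]; apply/asboolP; split.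
  exact: equivariant_pullback.
by rewrite diff_pullback f0.
Qed.

Definition cocycle_map (z : cocycle M n) : cocycle (res_gmodule phi M) n :=
  Cocycle (pullback_cocycle z).

Fact cocycle_map_is_zmod_morphism : zmod_morphism cocycle_map.
Proof. by move=> y z; apply: val_inj. Qed.

HB.instance Definition _ := GRing.isZmodMorphism.Build
  (cocycle M n) (cocycle (res_gmodule phi M) n)
  cocycle_map cocycle_map_is_zmod_morphism.

Lemma coboundaries_map (z : cocycle M n) :
  z \in @coboundaries L M n ->
  cocycle_map z \in @coboundaries G (res_gmodule phi M) n.
Proof.
case: z => f fZ /asboolP /= fB; apply/asboolP => /=; move: f fB {fZ}.
case: n => [|m] f /=; first by move->.
by case=> h hE ->; exists (pullback h); first exact: equivariant_pullback.
Qed.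

(* Independence of the representative is cohomology_map_pi below. *)
Definition cohomology_map (x : cohomology M n) :
    cohomology (res_gmodule phi M) n :=
  \pi_(cohomology (res_gmodule phi M) n) (cocycle_map (repr x)).

Lemma cohomology_map_pi (z : cocycle M n) :
  cohomology_map (\pi_(cohomology M n) z) =
    \pi_(cohomology (res_gmodule phi M) n) (cocycle_map z).
Proof.
apply/eqP; rewrite /cohomology_map -Quotient.idealrBE -raddfB.
by apply: coboundaries_map; rewrite Quotient.idealrBE reprK.
Qed.

Fact cohomology_map_is_zmod_morphism : zmod_morphism cohomology_map.
Proof.
move=> x y; rewrite -[x]reprK -[y]reprK -raddfB !cohomology_map_pi.
by rewrite !raddfB.
Qed.

HB.instance Definition _ := GRing.isZmodMorphism.Build
  (cohomology M n) (cohomology (res_gmodule phi M) n)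
  cohomology_map cohomology_map_is_zmod_morphism.

End InducedMap.

Arguments cohomology_map {G L} phi M n.

Section CohomologicalDimension.
Variables (G L : groupType) (phi : UMagmaMorphism.type G L).

Definition nonzero_in_degree (k : nat) :=
  exists M : gmodule L, exists x : cohomology M k, cohomology_map phi M k x != 0.

Definition is_max_degree (k : nat) :=
  nonzero_in_degree k /\ forall j, nonzero_in_degree j -> (j <= k)%N.

(* None stands for infinity. *)
Definition cd : option nat :=
  match pselect (exists k, is_max_degree k) with
  | left ex_max => Some (projT1 (cid ex_max))
  | right _ => None
  end.

End CohomologicalDimension.

Definition finitely_generated (G : groupType) :=
  exists s : seq G, forall S : {pred G},
    group_closed S -> {subset s <= S} -> forall x, x \in S.

(* Main.v *)
Require Import Defs.
From mathcomp.multinomials Require Import freeg.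
From mathcomp Require Import all_boot all_order all_algebra.
From HB Require Import structures.
From mathcomp Require Import boolp functions.

(** If [Gamma] is trivial then so is [phi], against the hypothesis that [phi]
    is nonzero.  So the equivalence says that, for a nonzero epimorphism,
    [cd phi] is never 0, and it is enough that [phi] is nonzero in degree 1.

    The class that shows this is the Berstein class of [Lambda]: the class in
    H^1(Lambda; I), where I is the augmentation ideal of Z[Lambda], of the
    cocycle [(x0, x1) |-> [x1] - [x0]].  It is the image of 1 under the
    connecting map of 0 -> I -> Z[Lambda] -> Z -> 0, so its vanishing would give
    a Lambda-invariant element of Z[Lambda] of augmentation 1.  This works in
    the same way for finite and infinite [Lambda].

    In detail, suppose that the pullback of the cocycle along [phi] is the
    coboundary of [h].  Then [b = [1] - h 1] has augmentation 1 and is fixed by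
    the image of [phi], which is all of [Lambda]
    ([trivial_of_berstein_class_eq0]).
    Being fixed, [b] has the same coefficient [c] at every group element, and
    its support is finite, so [1 = c * #|supp b|].  Thus [c] is nonzero, the
    support is the whole group, and it has one element
    ([trivial_of_invariant_deg1]).  Then [Lambda] is trivial and [phi] is
    zero, a contradiction. *)

Set Implicit Arguments.
Unset Strict Implicit.
Unset Printing Implicit Defensive.

Import GRing.Theory.

Section GroupRing.
Local Open Scope ring_scope.
Variable L : groupType.
Implicit Types (g h z : L) (D E : {freeg L}).

(** Left multiplication by [g] on the group ring, whose underlying group is
    the free abelian group on [L]. *)
Definition translate g D : {freeg L} :=
  \sum_(x <- dom D) << coeff x D *g (g * x)%g >>.

Lemma coeff_sum_dom z D :
  coeff z D = \sum_(x <- dom D) coeff x D * (x == z)%:R.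
Proof.
rewrite -[in LHS](freeg_sumE D) raddf_sum.
by apply: eq_bigr => x _; rewrite /= coeffU.
Qed.

Lemma deg_sum_dom D : deg D = \sum_(x <- dom D) coeff x D.
Proof.
rewrite -[in LHS](freeg_sumE D) raddf_sum.
by apply: eq_bigr => x _; rewrite /= degU.
Qed.

Lemma coeff_translate g D z : coeff z (translate g D) = coeff (g^-1 * z)%g D.
Proof.
rewrite [RHS]coeff_sum_dom /translate raddf_sum; apply: eq_bigr => x _.
by rewrite /= coeffU -(inj_eq (mulgI g) x) mulVKg.
Qed.

Lemma deg_translate g D : deg (translate g D) = deg D.
Proof.
rewrite [RHS]deg_sum_dom /translate raddf_sum.
by apply: eq_bigr => x _; rewrite /= degU.
Qed.

Lemma translateD g : {morph translate g : D E / D + E}.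
Proof.
move=> D E; apply/eqP/freeg_eqP => z.
by rewrite coeffD !coeff_translate coeffD.
Qed.

Lemma translate1 D : translate 1%g D = D.
Proof. by apply/eqP/freeg_eqP => z; rewrite coeff_translate invg1 mul1g. Qed.

Lemma translateM g h D : translate (g * h)%g D = translate g (translate h D).
Proof.
by apply/eqP/freeg_eqP => z; rewrite !coeff_translate invgM mulgA.
Qed.

Lemma translateB g : {morph translate g : D E / D - E}.
Proof.
move=> D E; apply/eqP/freeg_eqP => z.
by rewrite coeffB !coeff_translate coeffB.
Qed.

Lemma translateU g z : translate g << z >> = << (g * z)%g >>.
Proof.
apply/eqP/freeg_eqP => y; rewrite coeff_translate !coeffU.
by rewrite -(inj_eq (mulgI g) z) mulVKg.
Qed.

(** The coefficients of an invariant element are all equal, so its degree is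
    this common value times the size of its support.  When the degree is 1
    both factors are units: the support is everything, and a singleton. *)
Lemma trivial_of_invariant_deg1 D :
  (forall g, translate g D = D) -> deg D = 1 -> forall g, g = 1%g.
Proof.
move=> Dinv deg1.
have coeffE z : coeff z D = coeff 1%g D.
  by rewrite -{1}(Dinv z) coeff_translate mulVg.
have degE : coeff 1%g D * (size (dom D))%:Z = 1.
  rewrite -deg1 deg_sum_dom; under eq_bigr do rewrite coeffE.
  by rewrite big_const_seq count_predT iter_addr_0 -mulr_natr natz.
have coeff_neq0 : coeff 1%g D != 0.
  by apply/eqP => c0; rewrite c0 mul0r in degE.
have mem_domT z : z \in dom D by rewrite mem_dom coeffE.
have size_dom : size (dom D) = 1%N.
  by have /eqP := congr1 absz degE; rewrite abszM /= muln_eq1 => /andP[_ /eqP].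
case: (dom D) size_dom mem_domT => [|x [|//]] // _ memT g.
have := memT g; have := memT 1%g; rewrite !inE.
by move=> /eqP -> /eqP.
Qed.

End GroupRing.

Section AugmentationIdeal.
Local Open Scope ring_scope.
Variable L : groupType.

Definition augmentation_kernel : {pred {freeg L}} := fun D => deg D == 0.

Fact augmentation_kernel_zmod_closed : zmod_closed augmentation_kernel.
Proof.
split=> [|D E]; rewrite -!topredE /= /augmentation_kernel ?deg0 //.
by move=> /eqP D0 /eqP E0; rewrite degB D0 E0 subrr.
Qed.

HB.instance Definition _ := GRing.isZmodClosed.Build
  {freeg L} augmentation_kernel augmentation_kernel_zmod_closed.

Record augmentation := Augmentation {
  augmentation_val :> {freeg L};
  augmentationP : augmentation_val \in augmentation_kernel
}.

HB.instance Definition _ := [isSub for augmentation_val].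
HB.instance Definition _ := [Choice of augmentation by <:].
HB.instance Definition _ := [SubChoice_isSubZmodule of augmentation by <:].

Lemma deg_augmentation (D : augmentation) : deg (val D) = 0.
Proof. exact/eqP/(augmentationP D). Qed.

Fact translate_augmentation_kernel g (D : augmentation) :
  translate g (val D) \in augmentation_kernel.
Proof. by apply/eqP; rewrite deg_translate deg_augmentation. Qed.

Definition augmentation_act g (D : augmentation) : augmentation :=
  Augmentation (translate_augmentation_kernel g D).

Fact augmentation_actD g : {morph augmentation_act g : D E / D + E}.
Proof. by move=> D E; apply: val_inj; apply: translateD. Qed.

Fact augmentation_act1 D : augmentation_act 1%g D = D.
Proof. by apply: val_inj; apply: translate1. Qed.

Fact augmentation_actM g h D :
  augmentation_act (g * h)%g D = augmentation_act g (augmentation_act h D).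
Proof. by apply: val_inj; apply: translateM. Qed.

Definition augmentation_gmodule : gmodule L :=
  GModule augmentation_actD augmentation_act1 augmentation_actM.

End AugmentationIdeal.

Section BersteinClass.
Local Open Scope ring_scope.
Local Open Scope quotient_scope.
Variable L : groupType.

Fact berstein_augmentation (x y : L) :
  << y >> - << x >> \in @augmentation_kernel L.
Proof. by apply/eqP; rewrite degB !degU subrr. Qed.

(** The homogeneous form of the crossed homomorphism [g |-> [g] - [1]]. *)
Definition berstein_cochain : cochain (augmentation_gmodule L) 1 :=
  fun x => Augmentation (berstein_augmentation (x ord0) (x ord_max)).

Fact berstein_cochain_cocycle : berstein_cochain \in @cocycles L _ 1.
Proof.
apply/asboolP; split=> [g x|].
  by apply: val_inj; rewrite /= translateB !translateU.
apply/funext => x; apply: val_inj; rewrite /diff !big_ord_recl big_ord0 addr0.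
rewrite [LHS]/=.
have -> : lift ord0 ord_max = ord_max :> 'I_3 by apply: val_inj.
have -> : lift (lift ord0 ord0) ord_max = ord_max :> 'I_3 by apply: val_inj.
have -> : lift (lift ord0 ord0) ord0 = ord0 :> 'I_3 by apply: val_inj.
have -> : lift (lift ord0 (lift ord0 ord0)) ord_max = lift ord0 ord0 :> 'I_3.
  by apply: val_inj.
have -> : lift (lift ord0 (lift ord0 ord0)) ord0 = ord0 :> 'I_3.
  by apply: val_inj.
by rewrite opprB [X in _ + X]addrC !subrKA subrr.
Qed.

Definition berstein_cocycle : cocycle (augmentation_gmodule L) 1 :=
  Cocycle berstein_cochain_cocycle.

End BersteinClass.

Section Pullback.
Local Open Scope ring_scope.
Local Open Scope quotient_scope.
Variables (G L : groupType) (phi : UMagmaMorphism.type G L).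

(** Turns the vanishing of a class, a statement in a quotient group, into one
    about cochains. *)
Lemma cohomology_map_pi_eq0 (M : gmodule L) n (z : cocycle M n) :
  cohomology_map phi M n (\pi z) = 0 -> is_coboundary (pullback phi z).
Proof.
move=> /eqP; rewrite cohomology_map_pi.
have -> : 0 = \pi_(cohomology (res_gmodule phi M) n) 0 by rewrite raddf0.
by rewrite -Quotient.idealrBE subr0 => /asboolP.
Qed.

(** If the pulled back cocycle is the coboundary of [h], then [[phi g] - h g]
    does not depend on [g].  By equivariance [h g] is [phi g] applied to [h 1],
    so [[1] - h 1] is fixed by the image of [phi]; its degree is 1 because [h]
    takes values in the augmentation ideal. *)
Lemma trivial_of_berstein_class_eq0
    (phi_epi : forall l : L, exists g : G, phi g = l) :
  cohomology_map phi (augmentation_gmodule L) 1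
    (\pi_(cohomology (augmentation_gmodule L) 1) (berstein_cocycle L)) = 0 ->
  forall l : L, l = 1%g.
Proof.
move=> /cohomology_map_pi_eq0 [h h_equiv hE].
pose h1 : {freeg L} := val (h (fun _ => 1%g) : augmentation L).
apply: (@trivial_of_invariant_deg1 L (<< 1%g >> - h1)); last first.
  by rewrite degB degU deg_augmentation subr0.
move=> l; have [g phi_g] := phi_epi l.
pose x (i : 'I_2) : G := if i == ord0 then 1%g else g.
have h_g : h (x \o lift ord0) = augmentation_act l (h (fun _ => 1%g)).
  rewrite -phi_g -[RHS]h_equiv; congr h; apply/funext => i /=.
  by rewrite /x /= mulg1.
have h_1 : h (x \o lift (lift ord0 ord0)) = h (fun _ => 1%g).
  by congr h; apply/funext => i; rewrite /x /= (ord1 i).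
have /(congr1 (@augmentation_val L)) := congr1 (fun f => f x) hE.
rewrite /diff !big_ord_recl big_ord0 addr0 h_g h_1.
rewrite [LHS]/= [RHS]/= /x /= phi_g gmulf1 => eq_coboundary.
apply/eqP; rewrite translateB translateU mulg1 subr_eq addrAC.
by rewrite -addrA -eq_coboundary addrC subrK.
Qed.

End Pullback.

Theorem theorem1p3 (Gamma Lambda : groupType)
    (phi : UMagmaMorphism.type Gamma Lambda)
    (Gamma_fg : finitely_generated Gamma)
    (Lambda_fg : finitely_generated Lambda)
    (phi_epi : forall l : Lambda, exists g : Gamma, phi g = l)
    (phi_nonzero : ~ (forall g : Gamma, phi g = 1%g)) :
  cd phi = Some 0%N <-> (forall g : Gamma, g = 1%g).
Proof.
split=> [|Gamma1]; last by case: phi_nonzero => g; rewrite (Gamma1 g) gmulf1.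
rewrite /cd; case: pselect => // ex_max; case: (cid ex_max) => k [_ max_k] /= [k0].
rewrite {}k0 in max_k.
suff /max_k : nonzero_in_degree phi 1 by [].
pose M := augmentation_gmodule Lambda.
exists M, (\pi_(cohomology M 1) (berstein_cocycle Lambda))%qT.
apply/eqP => /(trivial_of_berstein_class_eq0 phi_epi) Lambda1.
by apply: phi_nonzero => g; apply: Lambda1.
Qed.
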